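(* Let $m\geq 2$, let $Q_{4m}=\langle a,b\mid a^{2m}=1,\ b^{2}=a^{m},\ bab^{-1}=a^{-1}\rangle$ be the generalized quaternion group of order $4m$, let $V$ be a rational FPF representation of $Q_{4m}$ of dimension $n=\dim_{\mathbb{Q}}V$, let $L\subset V$ be a $Q_{4m}$-invariant full-rank lattice, and consider the induced $Q_{4m}$-action on $V_{\mathbb{C}}/L$. Let $F$ be the set of points of $V_{\mathbb{C}}/L$ with nontrivial stabilizer and $\pi\colon V_{\mathbb{C}}/L\to V_{\mathbb{C}}/(Q_{4m}\ltimes L)$ the quotient map by $Q_{4m}$. Then the number of singular points of the quotient $V_{\mathbb{C}}/(Q_{4m}\ltimes L)$ is \[|\pi(F)|=2^{\frac{n}{2}-1}+\frac{1}{2}-\frac{\omega(2m)}{4m}+\frac{1}{4m}\sum_{p\mid 2m}p^{\frac{n}{p-1}}+\frac{1}{4m}\sum_{p^k\mid 2m} \varphi(p^k)\left(p^{\frac{n}{\varphi(p^k)}}-1\right),\] where $p$ ranges over the distinct prime divisors of $2m$, $p^k$ ranges over all prime power divisors of $2m$ ($p$ prime, $k\geq 1$), and $\omega(2m)$ is the number of distinct prime divisors of $2m$.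
   Context: A rational FPF (fixed-point-free) representation of a finite group $G$ is a nonzero finite-dimensional $\mathbb{Q}$-vector space $V$ with a linear $G$-action such that $\det(g-\mathrm{id}\mid V)\neq 0$ for every non-identity $g\in G$. A $G$-invariant full-rank lattice $L\subset V$ is a $G$-stable free $\mathbb{Z}$-submodule spanned by a $\mathbb{Q}$-basis of $V$. Put $V_{\mathbb{C}}=V\otimes_{\mathbb{Q}}\mathbb{C}$; the action of $G$ extends $\mathbb{C}$-linearly to $V_{\mathbb{C}}$ and induces an action on the torus $V_{\mathbb{C}}/L\cong(\mathbb{C}/\mathbb{Z})^n$ by $g\cdot[x]=[gx]$, with quotient $(V_{\mathbb{C}}/L)/G=V_{\mathbb{C}}/(G\ltimes L)$. The singular points of the quotient orbifold are by convention the points of $\pi(F)$, i.e. the images of points with nontrivial stabilizer. $\varphi$ is Euler's totient function. *)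

(* Defs.v *)
From HB Require Import structures.
From mathcomp Require Import all_boot all_order all_algebra all_fingroup.
From mathcomp Require Import all_character.
From mathcomp Require Import complex finmap.
From mathcomp Require Import all_classical all_reals all_analysis.

Set Implicit Arguments.
Unset Strict Implicit.
Unset Printing Implicit Defensive.

Import Order.TTheory GRing.Theory Num.Theory.

Local Open Scope classical_set_scope.
Local Open Scope ring_scope.
Local Open Scope quotient_scope.

(* The presentation determines G up to isomorphism: [\isog Grp] says that G is
   the largest finite group with these generators and relations, and the
   abstract group is itself finite (of order 4m). *)
Definition generalized_quaternion (m : nat) (gT : finGroupType)
    (G : {group gT}) : Prop :=
  (G \isog Grp (a : b : a ^+ (2 * m), b ^+ 2 = a ^+ m,
                        b * a * b^-1 = a^-1))%g.

(* Representations act on V = Q^n on the left, on column vectors: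
   g sends v to rG g *m v. *)
Definition fpf_repr (gT : finGroupType) (G : {group gT}) (n : nat)
    (rG : mx_representation rat G n) : Prop :=
  (0 < n)%N /\
  (forall g : gT, g \in G -> g != 1%g -> \det (rG g - 1%:M) != 0).

Definition full_rank_lattice (n : nat) (L : zmodClosed 'cV[rat]_n) : Prop :=
  exists b : n.-tuple 'cV[rat]_n,
    basis_of fullv b /\
    (forall v : 'cV[rat]_n,
       v \in L <-> exists z : 'I_n -> int, v = \sum_(i < n) tnth b i *~ z i).

Definition stable_lattice (gT : finGroupType) (G : {group gT}) (n : nat)
    (rG : mx_representation rat G n) (L : zmodClosed 'cV[rat]_n) : Prop :=
  forall g v, g \in G -> v \in L -> rG g *m v \in L.

Section ComplexTorus.
Variables (R : realType) (n : nat) (L : zmodClosed 'cV[rat]_n).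

(* The image of L under the inclusion of V = Q^n in V_C = C^n. *)
Definition latticeC : {pred 'cV[R[i]]_n} :=
  fun x => `[< exists2 v : 'cV[rat]_n, v \in L & x = map_mx ratr v >].

Lemma latticeC_zmod_closed : zmod_closed latticeC.
Proof.
split; first by apply/asboolP; exists 0; rewrite ?rpred0 ?map_mx0.
move=> _ _ /asboolP[u Lu ->] /asboolP[v Lv ->].
by apply/asboolP; exists (u - v); rewrite ?rpredB // map_mxB.
Qed.

HB.instance Definition _ :=
  GRing.isZmodClosed.Build 'cV[R[i]]_n latticeC latticeC_zmod_closed.

Definition torus : Type := Quotient.quot latticeC.
HB.instance Definition _ := EqQuotient.on torus.

End ComplexTorus.

Arguments latticeC R {n} L.

Section Quotient.
Variables (R : realType) (gT : finGroupType) (G : {group gT}) (n : nat).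
Variables (rG : mx_representation rat G n) (L : zmodClosed 'cV[rat]_n).
Local Notation T := (torus R L).

(* Defined through a representative; torus_actE below shows that the choice
   is irrelevant when L is stable. *)
Definition torus_act (g : gT) (x : T) : T :=
  \pi_T (map_mx ratr (rG g) *m generic_quotient.repr x).

Lemma torus_actE (g : gT) (x : 'cV[R[i]]_n) :
  stable_lattice rG L -> g \in G ->
  torus_act g (\pi_T x) = (\pi_T (map_mx ratr (rG g) *m x)).
Proof.
move=> stabL Gg; apply/eqP; rewrite -Quotient.idealrBE -mulmxBr.
have : generic_quotient.repr (\pi_T x) - x \in latticeC R L.
  by rewrite Quotient.idealrBE reprK.
move=> /asboolP[v Lv ->].
by apply/asboolP; exists (rG g *m v); rewrite ?stabL // map_mxM.
Qed.

(* The set F. *)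
Definition nontrivial_stabilizer : set T :=
  [set x | exists g, [/\ g \in G, g != 1%g & torus_act g x = x]].

(* Points of the quotient by G are orbits, so this is the quotient map pi. *)
Definition torus_orbit (x : T) : set T :=
  [set torus_act g x | g in [set g | g \in G]].

Definition singular_points : set (set T) :=
  torus_orbit @` nontrivial_stabilizer.

End Quotient.

Arguments singular_points R {gT G n} rG L.

(* Main.v *)
Require Import Defs.
From HB Require Import structures.
From mathcomp Require Import all_boot all_order all_algebra all_fingroup.
From mathcomp Require Import all_character.
From mathcomp Require Import complex finmap.
From mathcomp Require Import all_classical all_reals all_analysis.
From mathcomp Require Import all_solvable ring zify.

Set Implicit Arguments.
Unset Strict Implicit.
Unset Printing Implicit Defensive.

Import Order.TTheory GRing.Theory Num.Theory.

Local Open Scope classical_set_scope.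
Local Open Scope ring_scope.

(* By Burnside's lemma on F, |F/G| |G| = |F| + \sum_(g <> 1) |Fix g|, and
   F is the union over the primes p | 2m of the sets Fix (a^(2m/p)), which
   pairwise meet in 0 only, since a point fixed by an element of order p is
   killed by p.  If g has order p^k, then N = g - 1 is onto on the torus, and
   N^phi(p^k) is p times a unit of Z[g]; hence
   |Fix g|^phi(p^k) = |ker N^phi(p^k)| = |ker p| = p^n.  If the order of g is
   not a prime power, then a fixed point is killed by two distinct primes, so
   it is 0. *)

(** * Counting points and orbits *)

(** An element outside <a> squares to a^m, which is not 1, so it has order 4; hence all elements of
    prime order lie in the cyclic group <a>, which has a single subgroup of order p for each prime p
    | 2m. This is why the sets Fix (a^(2m/p)) exhaust F. The constants arise as follows. Each of the
    2m elements outside <a> fixes 2^(n/2) points, which gives 2^(n/2-1) after division by 4m. The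
    term 1/2 is the point 0 of F plus a summand 1 for each of the 2m - 1 non-identity elements of
    <a>, over 4m. The term with omega(2m) removes 0 from each of the sets that make up F. The
    obstacle is the size of Fix g, which is |det(g - 1)|. Passing to the kernel of a power of g - 1
    replaces this determinant by a count of torsion points, which a lattice basis makes visible. So
    |Fix g| is known through its phi(p^k)-th power, and a real root is taken only at the end. The
    torus is infinite, so finite subsets are counted through duplicate-free lists. *)

Definition enumerates (T : eqType) (s : seq T) (P : T -> Prop) : Prop :=
  uniq s /\ forall x, x \in s <-> P x.

Lemma enumerates_size (T : eqType) (s1 s2 : seq T) (P : T -> Prop) :
  enumerates s1 P -> enumerates s2 P -> size s1 = size s2.
Proof.
move=> [u1 e1] [u2 e2]; apply/perm_size/uniq_perm => // x.
by apply/idP/idP => [/e1/e2|/e2/e1].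
Qed.

(** The map [f] sends the kernel of its (j+1)-st iterate onto the kernel of the j-th one, and its
    fibres are cosets of ker [f]. The section [f'] need not be additive: it only selects a point in
    each fibre. *)
Lemma enumerates_ker_iter (T : zmodType) (f : {additive T -> T}) (f' : T -> T)
    (s : seq T) (j : nat) :
    cancel f' f -> enumerates s (fun x => f x = 0) ->
  exists2 s', enumerates s' (fun x => iter j f x = 0) & size s' = (size s ^ j)%N.
Proof.
move=> f'K [us es]; elim: j => [|j [s' [us' es'] sz]].
  by exists [:: 0] => //; split=> // x; rewrite inE; split=> /eqP.
exists [seq f' y + z | y <- s', z <- s]; last by rewrite size_allpairs sz expnSr.
split=> [|x].
  apply: allpairs_uniq => // _ _ /allpairsP[[y z] [/= _ sz1 ->]]
    /allpairsP[[y' z'] [/= _ sz2 ->]] /= eqyz.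
  have eqy : y = y'.
    have := congr1 f eqyz; rewrite !raddfD /= !f'K.
    by rewrite (es z).1 // (es z').1 // !addr0.
  by move: eqyz; rewrite eqy => /addrI ->.
rewrite iterSr; split=> [/allpairsP[[y z] [/= s'y sz1 ->]]|fx0].
  by rewrite raddfD f'K (es z).1 // addr0; apply/es'.
apply/allpairsP; exists (f x, x - f' (f x)); split => /=.
- exact/es'.
- by apply/es; rewrite raddfB f'K subrr.
- by rewrite addrC subrK.
Qed.

Lemma enumerates_card (T : choiceType) (s : seq T) (A : set T) :
  enumerates s A -> finite_set A /\ #|` fset_set A| = size s.
Proof.
move=> [us es].
have -> : A = [set` [fset x in s]%fset].
  by apply/seteqP; split=> x /=; rewrite inE => /es.
by rewrite set_fsetK card_fseq undup_id.
Qed.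

(** Burnside's lemma on the finite set listed by [s], which is stable because stabilizers along an
    orbit are conjugate. The identity fixes all of [s], whence the separate summand; a non-identity
    element has all its fixed points in [s]. *)
Lemma card_orbits_nontrivial_stabilizer (T : choiceType) (gT : finGroupType)
    (G : {group gT}) (act : gT -> T -> T) (s : seq T) (t : gT -> seq T) :
    (forall x, act 1%g x = x) ->
    {in G &, forall g h x, act (g * h)%g x = act g (act h x)} ->
    enumerates s (fun x => exists g, [/\ g \in G, g != 1%g & act g x = x]) ->
    {in G, forall g, g != 1%g -> enumerates (t g) (fun x => act g x = x)} ->
  exists2 o : seq (set T),
    enumerates o ((fun x => [set act g x | g in [set g | g \in G]]) @`
      [set x | exists g, [/\ g \in G, g != 1%g & act g x = x]])
    & (size o * #|G| = size s + \sum_(g in G | g != 1%g) size (t g))%N.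
Proof.
move=> act1 actM [us es] et.
have actVK g x : g \in G -> act g^-1%g (act g x) = x.
  by move=> Gg; rewrite -actM ?groupV // mulVg act1.
have s_act g x : g \in G -> x \in s -> act g x \in s.
  move=> Gg /es[h [Gh h1 hx]]; apply/es; exists (h ^ g^-1)%g.
  split; [by rewrite groupJ ?groupV | by rewrite conjg_eq1 |].
  by rewrite conjgE invgK !actM ?groupM ?groupV // actVK ?hx.
pose S := seq_sub s.
(* Library actions are right actions, hence the inverse. The default value of [insubd] is never
   reached for [g] in [G], since [s] is stable. *)
pose to (x : S) g := if g \in G then insubd x (act g^-1%g (val x)) else x.
have val_to x g : g \in G -> val (to x g) = act g^-1%g (val x).
  by move=> Gg; rewrite /to Gg val_insubd s_act ?groupV ?ssvalP.
have to_action : is_action G to.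
  split=> [g x y|x g h Gg Gh].
    have [Gg|Gg] := boolP (g \in G); last by rewrite /to (negPf Gg).
    move/(congr1 (act g \o val)); rewrite /= !val_to //.
    rewrite -[in act g^-1%g]/(act g^-1%g).
    rewrite -!actM ?groupV // mulgV !act1; exact: val_inj.
  apply: val_inj; rewrite !val_to ?groupM // invMg actM ?groupV //.
pose toA := Action to_action.
have acts : [acts G, on [set: S]%SET | toA].
  apply/fintype.subsetP => g Gg; rewrite !inE Gg /=.
  by apply/fintype.subsetP => x _; rewrite !inE.
pose orb := (orbit toA G @: [set: S])%SET.
(* Orbits are formed in the finite type [S]; [Phi] carries them injectively to sets of points of
   [T]. *)
pose Phi (Z : {set S}) : set T := [set y | exists2 z, z \in Z & val z = y].
have Phi_inj : injective Phi.
  move=> Z1 Z2 Z12; apply/setP => z.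
  have H (Z Z' : {set S}) : Phi Z = Phi Z' -> z \in Z -> z \in Z'.
    move=> e zZ; have : Phi Z (val z) by exists z.
    by rewrite e => -[z' z'Z /val_inj <-].
  by apply/idP/idP; apply: H.
exists [seq Phi Z | Z <- enum orb].
  split; first by rewrite map_inj_uniq ?enum_uniq.
  have PhiE x : Phi (orbit toA G x) = [set act g (val x) | g in [set g | g \in G]].
    apply/seteqP; split=> y /=.
      case=> _ /orbitP[g Gg <-] <-; exists g^-1%g; rewrite ?groupV //.
      by rewrite -val_to.
    case=> g Gg <-; exists (to x g^-1%g); last by rewrite val_to ?groupV // invgK.
    by apply/orbitP; exists g^-1%g; rewrite ?groupV.
  move=> A; split=> [/mapP[Z]|[x /es xs <-]].
    rewrite mem_enum => /imsetP[x _ ->] ->; rewrite PhiE.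
    by exists (val x) => //; apply/es/ssvalP.
  apply/mapP; exists (orbit toA G (SeqSub xs)); last by rewrite PhiE.
  by rewrite mem_enum imset_f.
rewrite size_map -cardE -(Frobenius_Cauchy acts) (bigD1 1%g) //=.
congr (_ + _)%N.
  by rewrite afix1 finset.setTI cardsT card_seq_sub.
apply: eq_bigr => g /andP[Gg g1].
have etg := et g Gg g1.
set Fg := 'Fix_(_ | _)[_]%g.
have eF : enumerates [seq val x | x <- enum Fg] (fun x => act g x = x).
  split=> [|x]; first by rewrite (map_inj_uniq val_inj) enum_uniq.
  split=> [/mapP[z]|gx].
    rewrite mem_enum => /finset.setIP[_ /afix1P/(congr1 val)].
    rewrite /= val_to // => gz ->.
    by rewrite -{1}gz -actM ?groupV // mulgV act1.
  have xs : x \in s by apply/es; exists g.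
  apply/mapP; exists (SeqSub xs) => //; rewrite mem_enum.
  apply/finset.setIP; split; first by rewrite finset.in_setT.
  apply/afix1P/val_inj.
  by rewrite /= val_to //= -{1}gx actVK.
by rewrite (enumerates_size etg eF) size_map -cardE.
Qed.

(** * A congruence for prime power cyclotomic polynomials *)

(* Modulo p the left side is (X - 1)^(p^k.+1) / (X - 1)^(p^k), and the cofactor
   of p takes the value 1 at X = 1. *)
Lemma prime_power_cyclotomic (p k : nat) : prime p ->
  exists r : {poly int}, \sum_(j < p) 'X^(p ^ k) ^+ j =
    ('X - 1) ^+ totient (p ^ k.+1) + p%:R * (1 + ('X - 1) * r) :> {poly int}.
Proof.
move=> p_pr; have p_gt0 := prime_gt0 p_pr.
have -> : totient (p ^ k.+1) = ((p - 1) * p ^ k)%N.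
  by rewrite totient_pfactor // subn1.
set P := \sum_(j < p) _; set D := P - ('X - 1) ^+ ((p - 1) * p ^ k).
have charFp : p \in [pchar 'F_p] by rewrite pchar_Fp.
have expB e : ('X - 1) ^+ (p ^ e)%N = 'X^(p ^ e) - 1 :> {poly 'F_p}.
  have pn : [pchar {poly 'F_p}].-nat (p ^ e)%N.
    by rewrite pnatX orbC (eq_pnat _ (pchar_poly _)) pnatE // charFp orbT.
  by rewrite exprDn_pchar // exprNn_pchar // expr1n.
have D0 : map_poly intr D = 0 :> {poly 'F_p}.
  have nz : ('X - 1) ^+ (p ^ k)%N != 0 :> {poly 'F_p}.
    by rewrite expf_neq0 // -polyC1 polyXsubC_eq0.
  apply: (mulIf nz); rewrite mul0r rmorphB /= rmorphXn /= rmorphB /=.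
  rewrite map_polyX rmorph1 mulrBl -exprD -mulSnr subn1 prednK // -expnS !expB.
  rewrite rmorph_sum /= (eq_bigr (fun j : 'I_p => 'X^(p ^ k) ^+ j)); last first.
    by move=> j _; rewrite !rmorphXn /= map_polyX.
  by rewrite mulrC -subrX1 -exprM -expnSr subrr.
have : (p%:Z %| zcontents D)%Z.
  rewrite dvdz_contents; apply/polyOverP => i.
  move/polyP/(_ i): D0; rewrite coef_map coef0 /= => /eqP.
  by rewrite -(dvdz_pcharf charFp).
case/dvdzP => z Dz.
pose h := z *: zprimitive D.
have Dh : D = p%:R * h.
  by rewrite {1}[D]zpolyEprim Dz mulrC -scalerA -natz scaler_nat mulr_natl.
(* At X = 1 each of the [p] summands of [P] is 1 and the power of X - 1 vanishes, its exponent being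
   positive; so [D] has value [p] there. *)
have : root (h - 1) 1.
  rewrite rootE hornerD hornerN hornerC subr_eq0.
  have nzp : p%:R != 0 :> int by rewrite pnatr_eq0 -lt0n.
  apply/eqP/(mulfI nzp); rewrite mulr1.
  transitivity D.[1]; first by rewrite Dh !mulr_natl hornerMn.
  rewrite hornerD hornerN horner_exp !hornerE subrr expr0n.
  rewrite muln_eq0 subn_eq0 leqNgt prime_gt1 // expn_eq0 eqn0Ngt p_gt0 subr0.
  rewrite horner_sum (eq_bigr (fun=> 1)) ?sumr_const ?card_ord // => j _.
  by rewrite !horner_exp hornerX !expr1n.
case/factor_theorem => r hr; exists r.
have -> : P = D + ('X - 1) ^+ ((p - 1) * p ^ k) by rewrite subrK.
rewrite addrC Dh; congr (_ + _ * _).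
by rewrite mulrC -[X in _ - X]polyC1 -hr addrC subrK.
Qed.

(** * The generalized quaternion group *)

(* The pair (i, s) stands for a^i b^s. *)
Definition quat (m : nat) : Type := ('Z_(2 * m) * bool)%type.

HB.instance Definition _ m := Finite.on (quat m).

Section QuatGroup.
Variable m : nat.

Definition quat_one : quat m := (0, false).
(** Moving b past a^j inverts a^j, and b^2 = a^m produces the summand [m%:R] when both factors
    contain b. *)
Definition quat_mul (x y : quat m) : quat m :=
  (x.1 + (if x.2 then - y.1 else y.1) + (if x.2 && y.2 then m%:R else 0),
   x.2 (+) y.2).
Definition quat_inv (x : quat m) : quat m :=
  (if x.2 then x.1 + m%:R else - x.1, x.2).

(** Conjugation by b fixes a^m because a^m is its own inverse; associativity of [quat_mul] rests on
    this. *)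
Lemma quat_natN : - m%:R = m%:R :> 'Z_(2 * m).
Proof.
apply/eqP; rewrite eq_sym -addr_eq0 -natrD addnn -mul2n.
case: m => [|k]; first by [].
by rewrite pchar_Zp //; lia.
Qed.

Lemma quat_mulA : associative quat_mul.
Proof.
move=> [i s] [j t] [k u]; rewrite /quat_mul /= addbA; congr (_, _).
case: s t u => [] [] [] /=; rewrite ?opprD ?opprK ?quat_natN ?oppr0; ring.
Qed.

Lemma quat_mul1 : left_id quat_one quat_mul.
Proof. by move=> [i s]; rewrite /quat_mul /= add0r addr0. Qed.

Lemma quat_mulV : left_inverse quat_one quat_inv quat_mul.
Proof.
move=> [i []]; rewrite /quat_mul /quat_inv /quat_one /=; congr (_, _).
  by rewrite -{1}quat_natN; ring.
by rewrite addNr addr0.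
Qed.

HB.instance Definition _ := Finite_isGroup.Build (quat m)
  quat_mulA quat_mul1 quat_mulV.

Definition quat_a : quat m := (1, false).
Definition quat_b : quat m := (0, true).

Lemma quat_aX k : (quat_a ^+ k)%g = (k%:R, false).
Proof.
elim: k => // k IHk; rewrite expgS IHk.
by rewrite /mulg /= /quat_mul /= addr0 -natr1 addrC.
Qed.

End QuatGroup.

Lemma card_quat m : (0 < m)%N -> #|[set: quat m]%SET| = (4 * m)%N.
Proof.
move=> m_gt0; rewrite cardsT card_prod card_bool card_ord Zp_cast; lia.
Qed.

(** Makes the explicit model of order 4m a homomorphic image of every group with this presentation,
    so the relations cannot collapse such a group to a smaller order. *)
Lemma quat_presentation m : (0 < m)%N ->
  ([set: quat m]%SET \homg Grp (a : b : a ^+ (2 * m), b ^+ 2 = a ^+ m,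
                        b * a * b^-1 = a^-1))%g.
Proof.
move=> m_gt0; apply/existsP; exists (quat_a m, quat_b m) => /=.
rewrite !xpair_eqE /=; apply/and4P; split.
- apply/eqP/setP => -[i s]; rewrite finset.in_setT.
  have ha : (quat_a m \in <[quat_a m]> <*> <[quat_b m]>)%g.
    by rewrite mem_gen // inE cycle_id.
  have hb : (quat_b m \in <[quat_a m]> <*> <[quat_b m]>)%g.
    by rewrite mem_gen // inE cycle_id orbT.
  have -> : (i, s) = (quat_a m ^+ i * quat_b m ^+ s)%g :> quat m.
    rewrite quat_aX natr_Zp; case: s; rewrite ?expg1 ?expg0 ?mulg1 //.
    by rewrite /mulg /= /quat_mul /= !addr0.
  by rewrite groupM ?groupX.
- by rewrite quat_aX pchar_Zp //; lia.
- rewrite quat_aX expgS expg1 /mulg /= /quat_mul /=.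
  by rewrite oppr0 !add0r.
- rewrite /mulg /invg /= /quat_mul /quat_inv /= /quat_one.
  by rewrite eqxx andbT; apply/eqP; ring.
Qed.

(** The relations give #[a] <= 2m and |G| <= 2 #[a], and the model gives |G| >= 4m; so all three
    bounds are equalities. *)
Lemma generalized_quaternionP m (gT : finGroupType) (G : {group gT}) :
    (0 < m)%N -> generalized_quaternion m G ->
  exists a, [/\ a \in G, #[a]%g = (2 * m)%N, #|G| = (4 * m)%N
    & forall g, g \in G -> g \notin <[a]>%g -> (g ^+ 2 = a ^+ m)%g].
Proof.
move=> m_gt0 isoG; have /existsP[[a b] /=] := isoGrp_hom isoG.
rewrite !xpair_eqE /= => /and4P[/eqP defG /eqP a2m /eqP b2 /eqP ba].
have le_4m : (4 * m <= #|G|)%N.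
  rewrite -card_quat // dvdn_leq ?cardG_gt0 // card_homg //.
  by rewrite isoG quat_presentation.
have Ga : a \in G by rewrite -defG mem_gen // inE cycle_id.
have Gb : b \in G by rewrite -defG mem_gen // inE cycle_id orbT.
have ab : (a ^ b^-1 = a^-1)%g by rewrite conjgE invgK mulgA.
have nab : (b \in 'N(<[a]>))%g.
  rewrite -groupV inE -cycleJ ab cycleV //.
have defG' : (<[a]> * <[b]>)%g = G :> {set _}.
  by rewrite -norm_joinEr ?cycle_subG.
(* Since b normalizes <a> and b^2 lies in <a>, only the parity of the exponent of b matters. *)
have sG : (G \subset <[a]> :|: <[a]> :* b)%g.
  rewrite -defG'; apply/fintype.subsetP => _ /mulsgP[x y ax /cycleP[k ->] ->].
  rewrite -(odd_double_half k) expgD -muln2 mulnC expgM b2 -expgM.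
  case: (odd k) => /=; rewrite ?expg0 ?expg1 ?mul1g.
    have -> : (x * (b * a ^+ (m * k./2)) = x * (a ^+ (m * k./2) ^ b^-1) * b)%g.
      by rewrite conjgE invgK !mulgA mulgKV.
    rewrite inE mem_rcoset mulgK orbC groupM //.
    by rewrite conjXg ab groupX ?groupV ?cycle_id.
  by rewrite inE groupM ?mem_cycle.
have le_a : (#[a]%g <= 2 * m)%N by rewrite dvdn_leq ?order_dvdn ?a2m //; lia.
have le_G : (#|G| <= #[a]%g + #[a]%g)%N.
  by apply: leq_trans (subset_leq_card sG) _; rewrite cardsU card_rcoset leq_subr.
have oa : #[a]%g = (2 * m)%N.
  apply/eqP; rewrite eqn_leq le_a /=.
  by move: (leq_trans le_4m le_G); rewrite addnn -mul2n; lia.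
have oG : #|G| = (4 * m)%N.
  apply/eqP; rewrite eqn_leq le_4m andbT (leq_trans le_G) // oa; lia.
exists a; split=> //.
move=> g /(fintype.subsetP sG); rewrite inE => /orP[-> // | ] + _.
case/rcosetP => x /cycleP[i ->] ->.
(* The computation is (a^i b)^2 = a^i (b a^i b^-1) b^2 = b^2 = a^m. *)
rewrite expgS expg1 !mulgA -(mulgA _ b) -(mulgKV b (b * a ^+ i)%g).
have -> : (b * a ^+ i * b^-1 = a ^- i)%g.
  by rewrite -expVgn -ab -conjXg conjgE invgK mulgA.
by rewrite !mulgA mulgV mul1g -b2 expgS expg1.
Qed.

(** * Endomorphisms of the torus *)

HB.instance Definition _ (R : realType) n (L : zmodClosed 'cV[rat]_n) :=
  GRing.Zmodule.copy (torus R L) (Quotient.quot (latticeC R L)).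

Section TorusEndomorphisms.
Variables (R : realType) (n : nat) (L : zmodClosed 'cV[rat]_n).
Local Notation C := R[i].
Local Notation T := (torus R L).
Local Notation "\pi x" := (\pi_T x)%qT (at level 10, x at level 9).

Lemma torus_piD (u v : 'cV[C]_n) : \pi (u + v) = \pi u + \pi v :> T.
Proof. exact: Quotient.pi_add. Qed.

Lemma torus_pi0 : \pi 0 = 0 :> T.
Proof. by apply: (addrI (\pi 0)); rewrite -torus_piD !addr0. Qed.

Lemma torus_piN (u : 'cV[C]_n) : \pi (- u) = - \pi u :> T.
Proof. by apply: (addrI (\pi u)); rewrite -torus_piD !subrr torus_pi0. Qed.

Lemma torus_piMn (u : 'cV[C]_n) k : \pi (u *+ k) = \pi u *+ k :> T.
Proof. by elim: k => [|k IHk]; rewrite ?torus_pi0 // !mulrS torus_piD IHk. Qed.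

Lemma torus_pi_eq0 (u : 'cV[C]_n) : (\pi u == 0 :> T) = (u \in latticeC R L).
Proof.
by rewrite -torus_pi0; apply/idP/idP; rewrite -[X in X \in _]subr0 Quotient.idealrBE.
Qed.

Definition lattice_endo (A : 'M[C]_n) : Prop :=
  forall v, v \in latticeC R L -> A *m v \in latticeC R L.

(** Defined for every matrix, so that sums and inverses of group elements can act too. If [A] does
    not preserve the lattice, the value depends on the chosen representative. *)
Definition torus_mul (A : 'M[C]_n) (x : T) : T :=
  \pi (A *m generic_quotient.repr x).

Lemma torus_mul_pi A v : lattice_endo A -> torus_mul A (\pi v) = \pi (A *m v).
Proof.
move=> LA; apply/eqP; rewrite -subr_eq0 -torus_piN -torus_piD -mulmxBr.
by rewrite torus_pi_eq0 LA // -torus_pi_eq0 torus_piD torus_piN reprK subrr.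
Qed.


Lemma torus_pi_surj (x : T) : exists v, x = \pi v.
Proof. by exists (generic_quotient.repr x); rewrite reprK. Qed.

Lemma torus_mulDr A x y : lattice_endo A ->
  torus_mul A (x + y) = torus_mul A x + torus_mul A y.
Proof.
have [u ->] := torus_pi_surj x; have [v ->] := torus_pi_surj y => LA.
by rewrite -torus_piD !torus_mul_pi // mulmxDr torus_piD.
Qed.

Lemma torus_mul0r A : lattice_endo A -> torus_mul A 0 = 0.
Proof. by move=> LA; rewrite -torus_pi0 torus_mul_pi // mulmx0. Qed.

Lemma torus_mulB A x y : lattice_endo A ->
  torus_mul A (x - y) = torus_mul A x - torus_mul A y.
Proof. by move=> LA; rewrite -{2}(subrK y x) (@torus_mulDr A (x - y) y) // addrK. Qed.

Lemma torus_mul0 x : torus_mul 0 x = 0.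
Proof. by rewrite /torus_mul mul0mx torus_pi0. Qed.

Lemma torus_mul1 x : torus_mul 1%:M x = x.
Proof. by rewrite /torus_mul mul1mx reprK. Qed.

Lemma torus_mulDl A B x : torus_mul (A + B) x = torus_mul A x + torus_mul B x.
Proof. by rewrite /torus_mul mulmxDl torus_piD. Qed.

Lemma torus_mulNl A x : torus_mul (- A) x = - torus_mul A x.
Proof. by rewrite /torus_mul mulNmx torus_piN. Qed.

(** The inner factor is applied to the representative itself, so [B] may be any matrix; this later
    lets the inverse of g - 1 serve as a section of g - 1. *)
Lemma torus_mulM A B x : lattice_endo A ->
  torus_mul (A *m B) x = torus_mul A (torus_mul B x).
Proof. move=> LA; rewrite -[torus_mul B x]/(\pi (B *m generic_quotient.repr x)).
by rewrite torus_mul_pi // mulmxA. Qed.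

Lemma lattice_endo0 : lattice_endo 0.
Proof. by move=> v _; rewrite mul0mx rpred0. Qed.

Lemma lattice_endo1 : lattice_endo 1%:M.
Proof. by move=> v Lv; rewrite mul1mx. Qed.

Lemma lattice_endoD A B : lattice_endo A -> lattice_endo B -> lattice_endo (A + B).
Proof. by move=> LA LB v Lv; rewrite mulmxDl rpredD ?LA ?LB. Qed.

Lemma lattice_endoN A : lattice_endo A -> lattice_endo (- A).
Proof. by move=> LA v Lv; rewrite mulNmx rpredN LA. Qed.

Lemma lattice_endoM A B : lattice_endo A -> lattice_endo B -> lattice_endo (A *m B).
Proof. by move=> LA LB v Lv; rewrite -mulmxA LA // LB. Qed.

End TorusEndomorphisms.

Section IntegralPolynomials.
Variables (R : realType) (n : nat) (L : zmodClosed 'cV[rat]_n.+1).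
Variable A : 'M[R[i]]_n.+1.
Hypothesis LA : lattice_endo L A.

(** Integer coefficients keep the lattice stable, so the commutative ring Z[X] acts on the torus
    through [A]. *)
Definition int_horner (P : {poly int}) : 'M[R[i]]_n.+1 :=
  horner_mx A (map_poly intr P).

Lemma int_horner_is_zmod_morphism : zmod_morphism int_horner.
Proof. by move=> P Q; rewrite /int_horner !rmorphB. Qed.

Lemma int_horner_is_monoid_morphism : monoid_morphism int_horner.
Proof. by split=> [|P Q]; rewrite /int_horner ?rmorph1 ?rmorphM. Qed.

HB.instance Definition _ :=
  GRing.isZmodMorphism.Build {poly int} 'M[R[i]]_n.+1 int_horner
    int_horner_is_zmod_morphism.
HB.instance Definition _ :=
  GRing.isMonoidMorphism.Build {poly int} 'M[R[i]]_n.+1 int_horner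
    int_horner_is_monoid_morphism.

Lemma int_hornerX : int_horner 'X = A.
Proof. by rewrite /int_horner map_polyX horner_mx_X. Qed.

Lemma int_hornerX_sub1 : int_horner ('X - 1) = A - 1%:M.
Proof. by rewrite rmorphB (rmorph1 int_horner) /= int_hornerX. Qed.

Lemma lattice_endo_horner P : lattice_endo L (int_horner P).
Proof.
elim/poly_ind: P => [|P c IHP]; first by rewrite rmorph0; apply: lattice_endo0.
rewrite rmorphD rmorphM /= int_hornerX; apply: lattice_endoD.
  exact: lattice_endoM.
rewrite -[c]intz polyCMz rmorph_int.
have Lnat k : lattice_endo L (k%:R : 'M[R[i]]_n.+1).
  elim: k => [|k IHk]; first exact: lattice_endo0.
  by rewrite mulrS; apply: lattice_endoD => //; apply: lattice_endo1.
by case: c => k; [|rewrite NegzE mulrNz; apply: lattice_endoN]; apply: Lnat.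
Qed.

Definition torus_horner (P : {poly int}) : torus R L -> torus R L :=
  torus_mul (int_horner P).

Lemma torus_hornerM P Q x : torus_horner (P * Q) x = torus_horner P (torus_horner Q x).
Proof.
by rewrite /torus_horner rmorphM /= torus_mulM //; apply: lattice_endo_horner.
Qed.

Lemma torus_hornerC P Q x :
  torus_horner P (torus_horner Q x) = torus_horner Q (torus_horner P x).
Proof. by rewrite -!torus_hornerM mulrC. Qed.

Lemma torus_hornerD P Q x : torus_horner (P + Q) x = torus_horner P x + torus_horner Q x.
Proof. by rewrite /torus_horner rmorphD torus_mulDl. Qed.

Lemma torus_hornerN P x : torus_horner (- P) x = - torus_horner P x.
Proof. by rewrite /torus_horner rmorphN torus_mulNl. Qed.

Lemma torus_horner1 x : torus_horner 1 x = x.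
Proof. by rewrite /torus_horner rmorph1 torus_mul1. Qed.

Lemma torus_horner_nat k x : torus_horner k%:R x = x *+ k.
Proof.
elim: k => [|k IHk]; first by rewrite /torus_horner rmorph0 torus_mul0.
by rewrite !mulrS torus_hornerD torus_horner1 IHk.
Qed.

Lemma torus_horner0r P : torus_horner P 0 = 0.
Proof. by rewrite /torus_horner torus_mul0r //; apply: lattice_endo_horner. Qed.

Lemma torus_hornerX x : torus_horner 'X x = torus_mul A x.
Proof. by rewrite /torus_horner int_hornerX. Qed.

Lemma torus_horner_exp P k x : torus_horner (P ^+ k) x = iter k (torus_horner P) x.
Proof.
elim: k => [|k IHk]; first by rewrite torus_horner1.
by rewrite exprS torus_hornerM IHk.
Qed.

Section PrimePowerOrder.
Variables p k : nat.
Hypothesis p_pr : prime p.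
Hypothesis A_cyclotomic : int_horner (\sum_(j < p) 'X^(p ^ k) ^+ j) = 0.

(* X - 1 acts nilpotently on either kernel, so the factor 1 + (X - 1) r of
   [prime_power_cyclotomic] acts invertibly there. *)
Lemma ker_sub1_totient x :
  iter (totient (p ^ k.+1)) (torus_horner ('X - 1)) x = 0 <-> x *+ p = 0.
Proof.
have [r Dr] := prime_power_cyclotomic k p_pr.
rewrite -torus_horner_exp.
pose N : {poly int} := ('X - 1) ^+ totient (p ^ k.+1).
pose u : {poly int} := 1 + ('X - 1) * r; rewrite -/N -/u in Dr *.
have NuE y : torus_horner N y = - torus_horner u (y *+ p).
  apply/eqP; rewrite -addr_eq0 -(torus_horner_nat p y) -torus_hornerM (mulrC u).
  by rewrite -torus_hornerD -Dr /torus_horner A_cyclotomic torus_mul0.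
split=> [Nx0|xp0]; last by rewrite NuE xp0 torus_horner0r oppr0.
set y := x *+ p.
have Ny0 : torus_horner N y = 0.
  by rewrite /y -torus_horner_nat torus_hornerC Nx0 torus_horner0r.
have uy0 : torus_horner u y = 0 by apply/eqP; rewrite -oppr_eq0 -NuE Nx0.
have yE : y = torus_horner (- (('X - 1) * r)) y.
  apply/eqP; rewrite -subr_eq0 -torus_hornerN opprK -{1}(torus_horner1 y).
  by rewrite -torus_hornerD; apply/eqP.
(* The power with j = phi(p^(k+1)) has [N] as a factor, and [N] kills [y]. *)
have yEk j : y = torus_horner ((- (('X - 1) * r)) ^+ j) y.
  elim: j => [|j IHj]; first by rewrite torus_horner1.
  by rewrite exprS torus_hornerM -IHj.
rewrite (yEk (totient (p ^ k.+1))) -mulrN exprMn mulrC torus_hornerM.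
by rewrite -/N Ny0 torus_horner0r.
Qed.

End PrimePowerOrder.
End IntegralPolynomials.

(** * Torsion points *)

Section Torsion.
Variables (R : realType) (n : nat) (L : zmodClosed 'cV[rat]_n).
Local Notation C := R[i].
Local Notation "\pi x" := (\pi_(torus R L) x)%qT (at level 10, x at level 9).

(** [B] has the lattice basis as its columns, so it is rational and invertible, and it stays
    invertible over the complex numbers. *)
Lemma full_rank_latticeC : full_rank_lattice L ->
  exists2 B : 'M[C]_n, B \in unitmx & forall x, x \in latticeC R L <->
    exists z : 'cV[int]_n, x = B *m map_mx intr z.
Proof.
case=> b [/andP[_ /freeP free_b] bL].
pose B : 'M[rat]_n := \matrix_(i, j) tnth b j i 0.
have BE (z : 'cV[rat]_n) : B *m z = \sum_(i < n) z i 0 *: tnth b i.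
  apply/matrixP => i j; rewrite !mxE summxE; apply: eq_bigr => k _.
  by rewrite !mxE !ord1 mulrC.
have uB : B \in unitmx.
  rewrite -unitmx_tr -row_free_unit; apply: inj_row_free => v vB0.
  have : B *m v^T = 0 by rewrite -[B]trmxK -trmx_mul vB0 trmx0.
  rewrite BE => v0; apply/rowP => i; rewrite mxE.
  have := free_b (fun i => v^T i 0) _ i; rewrite mxE; apply.
  by rewrite -[RHS]v0; apply: eq_bigr => k _; rewrite (tnth_nth 0).
exists (map_mx ratr B); first by rewrite map_unitmx.
have ratr_z (z : 'cV[int]_n) :
    map_mx ratr (map_mx intr z : 'cV[rat]_n) = map_mx intr z :> 'cV[C]_n.
  by apply/matrixP => i j; rewrite !mxE ratr_int.
move=> x; split=> [/asboolP[v /bL[z ->] ->]|[z ->]].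
  exists (\col_i z i); rewrite -ratr_z -map_mxM BE; congr map_mx.
  by apply: eq_bigr => i _; rewrite !mxE scaler_int.
apply/asboolP; exists (B *m map_mx intr z); last by rewrite map_mxM ratr_z.
apply/bL; exists (fun i => z i 0); rewrite BE.
by apply: eq_bigr => i _; rewrite !mxE scaler_int.
Qed.

(** The p-torsion is p^-1 L / L, with representatives B (k/p) for vectors k with entries in [0,
    p). *)
Lemma torus_torsion p : full_rank_lattice L -> (0 < p)%N ->
  exists2 s, enumerates s (fun x : torus R L => x *+ p = 0) &
    size s = (p ^ n)%N.
Proof.
move=> /full_rank_latticeC[B uB BL] p_gt0.
have p_nz : p%:R != 0 :> C by rewrite pnatr_eq0 -lt0n.
pose lift (k : 'cV['I_p]_n) : 'cV[C]_n := map_mx (fun i : 'I_p => (i : nat)%:R) k.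
pose pt k : torus R L := \pi (B *m (p%:R^-1 *: lift k)).
have BI : injective (mulmx B : 'cV[C]_n -> _).
  exact: can_inj (mulKmx uB).
exists (codom pt); last by rewrite size_codom card_mx card_ord muln1.
split=> [|x].
  apply/injectiveP => k k' /eqP; rewrite -subr_eq0 -torus_piN -torus_piD.
  rewrite torus_pi_eq0 -mulmxBr => /BL[z /BI].
  move/(congr1 (fun v => p%:R *: v)); rewrite scalerBr !scalerA mulfV // !scale1r.
  move/matrixP => kz; apply/matrixP => i j; apply/ord_inj.
  have : ((k i j)%:Z - (k' i j)%:Z)%:~R = (p%:Z * z i j)%:~R :> C.
    by rewrite rmorphB rmorphM /= -!pmulrn; have := kz i j; rewrite !mxE.
  move/intr_inj; have := ltn_ord (k i j); have := ltn_ord (k' i j).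
  move: (z i j) (nat_of_ord (k i j)) (nat_of_ord (k' i j)) => t a b lb la abt.
  (* Here a - b = p t with a and b in [0, p), which forces t = 0. *)
  have [t_lt0|t_gt0|t0] := ltrgtP t 0; last by move: abt; rewrite t0; lia.
    have : p%:Z * t <= p%:Z * -1 by rewrite ler_pM2l; lia.
    by move: abt; rewrite mulrN1; lia.
  have : p%:Z * 1 <= p%:Z * t by rewrite ler_pM2l; lia.
  by move: abt; rewrite mulr1; lia.
split=> [/codomP[k ->]|xp0].
  apply/eqP; rewrite -torus_piMn torus_pi_eq0; apply/BL.
  exists (map_mx (fun i : 'I_p => (i : nat)%:Z) k).
  rewrite -scaler_nat scalemxAr scalerA mulfV // scale1r; congr (_ *m _).
  by apply/matrixP => i j; rewrite !mxE.
have [v xE] := torus_pi_surj x; move/eqP: xp0.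
rewrite xE -torus_piMn torus_pi_eq0 => /BL[z zE].
have zp i j : (`|(z i j %% p)%Z|%N < p)%N.
  have := ltz_pmod (z i j) (_ : 0 < p%:Z); have := modz_ge0 (z i j) (_ : p%:Z != 0).
  by lia.
(* The remainders of [z] modulo [p] label the point; the quotients are the coordinates of the
   lattice vector between the two representatives. *)
apply/codomP; exists (\matrix_(i, j) Ordinal (zp i j)).
apply/eqP; rewrite -subr_eq0 -torus_piN -torus_piD torus_pi_eq0; apply/BL.
exists (map_mx (fun t => (t %/ p)%Z) z).
have -> : v = B *m (p%:R^-1 *: map_mx intr z).
  by rewrite -scalemxAr -zE -(scaler_nat p v) scalerA mulVf // scale1r.
rewrite -mulmxBr -scalerBr; congr (_ *m _).
apply/matrixP => i j; rewrite !mxE; apply: (mulfI p_nz).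
rewrite mulrA mulfV // mul1r.
have := modz_ge0 (z i j) (_ : p%:Z != 0) => zge0.
have -> : `|(z i j %% p)%Z|%N%:R = ((z i j %% p)%Z)%:~R :> C.
  by rewrite pmulrn gez0_abs // zge0 //; lia.
rewrite [in p%:R * _]pmulrn -rmorphM -rmorphB /= {1}(divz_eq (z i j) p).
by rewrite addrK mulrC.
Qed.

End Torsion.

(** * Fixed points *)

Lemma mulrn_coprime_eq0 (V : zmodType) (x : V) p q : coprime p q -> (0 < p)%N ->
  x *+ p = 0 -> x *+ q = 0 -> x = 0.
Proof.
move=> /eqP pq p_gt0 xp xq; have [u v uv _] := egcdnP q p_gt0.
have : x *+ (u * p) = x *+ (v * q + gcdn p q) by rewrite uv.
by rewrite mulrnDr (mulnC u) (mulnC v) !mulrnA xp xq !mul0rn add0r pq mulr1n.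
Qed.

Section FixedPoints.
Variables (R : realType) (gT : finGroupType) (G : {group gT}) (n : nat).
Variables (rG : mx_representation rat G n.+1) (L : zmodClosed 'cV[rat]_n.+1).
Hypothesis fpfG : fpf_repr rG.
Hypothesis stabL : stable_lattice rG L.
Local Notation T := (torus R L).
Local Notation act := (@torus_act R gT G n.+1 rG L).
Let rC g : 'M[R[i]]_n.+1 := map_mx ratr (rG g).

Lemma lattice_endo_repr g : g \in G -> lattice_endo L (rC g).
Proof.
move=> Gg _ /asboolP[v Lv ->]; apply/asboolP.
by exists (rG g *m v); rewrite ?map_mxM //; apply: stabL.
Qed.

Lemma torus_act1 x : act 1%g x = x.
Proof. by rewrite /torus_act repr_mx1 map_mx1 mul1mx reprK. Qed.

Lemma torus_actM g h x : g \in G -> h \in G -> act (g * h)%g x = act g (act h x).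
Proof.
move=> Gg Gh; rewrite /torus_act repr_mxM // map_mxM.
exact/torus_mulM/lattice_endo_repr.
Qed.

Lemma torus_act0 g : g \in G -> act g 0 = 0.
Proof. by move/lattice_endo_repr/torus_mul0r. Qed.

Lemma torus_act_fixX g x i : g \in G -> act g x = x -> act (g ^+ i)%g x = x.
Proof.
move=> Gg gx; elim: i => [|i IHi]; first by rewrite expg0 torus_act1.
by rewrite expgS torus_actM ?groupX // IHi.
Qed.

Lemma fpf_sub1_unit g : g \in G -> g != 1%g -> rC g - 1%:M \in unitmx.
Proof.
move=> Gg g1; rewrite unitmxE unitfE -(map_mx1 (@ratr R[i])) -map_mxB det_map_mx.
by rewrite fmorph_eq0 fpfG.2.
Qed.

Lemma int_hornerXn g i : g \in G -> int_horner (rC g) 'X^i = rC (g ^+ i)%g.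
Proof.
move=> Gg; rewrite rmorphXn /= int_hornerX.
elim: i => [|i IHi]; first by rewrite /rC repr_mx1 map_mx1.
by rewrite exprS IHi expgS /rC repr_mxM ?groupX // map_mxM.
Qed.

(** With h = g^(p^k), which is not 1, the product of h - 1 and the sum of the h^j is h^p - 1 = 0,
    and h - 1 is invertible by the FPF condition. *)
Lemma int_horner_cyclotomic g p k : prime p -> g \in G -> #[g]%g = (p ^ k.+1)%N ->
  int_horner (rC g) (\sum_(j < p) 'X^(p ^ k) ^+ j) = 0.
Proof.
move=> p_pr Gg og; set P := \sum_(j < p) _.
have g1 : (g ^+ (p ^ k))%g != 1%g.
  by rewrite -order_dvdn og pfactor_dvdn ?pfactorK ?ltnn ?expn_gt0 ?prime_gt0.
have := fpf_sub1_unit (groupX _ Gg) g1.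
rewrite -int_hornerXn // => uq.
apply: (can_inj (mulKmx uq)); rewrite mulmx0 -[1%:M](rmorph1 (int_horner (rC g))).
rewrite -rmorphB -[LHS](rmorphM (int_horner (rC g))) -subrX1 -exprM -expnSr.
rewrite rmorphB /= int_hornerXn // -og expg_order /rC repr_mx1 map_mx1.
rewrite (rmorph1 (int_horner _)).
exact: subrr.
Qed.

(** Each of the [p] powers of [g] in the vanishing cyclotomic sum fixes [x], so the sum sends [x] to
    p x. *)
Lemma fix_prime_power_torsion g p k x : prime p -> g \in G -> #[g]%g = (p ^ k.+1)%N ->
  act g x = x -> x *+ p = 0.
Proof.
move=> p_pr Gg og gx.
have := torus_mul0 x; rewrite -(int_horner_cyclotomic p_pr Gg og) => <-.
have H (s : seq nat) :
    torus_horner (rC g) (\sum_(j <- s) 'X^(p ^ k) ^+ j) x = x *+ size s.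
  elim: s => [|j s IHs]; first by rewrite big_nil /torus_horner rmorph0 torus_mul0.
  rewrite big_cons torus_hornerD IHs mulrS; congr (_ + _).
  rewrite -exprM /torus_horner int_hornerXn //.
  exact: (torus_act_fixX _ Gg gx).
rewrite -(big_mkord xpredT (fun j => 'X^(p ^ k) ^+ j)).
by rewrite -[RHS]/(torus_horner (rC g) _ x) H size_iota subn0.
Qed.

Lemma card_fix_prime_power g p k : full_rank_lattice L -> prime p -> g \in G ->
    #[g]%g = (p ^ k.+1)%N ->
  exists2 s, enumerates s (fun x => act g x = x) &
    (size s ^ totient (p ^ k.+1) = p ^ n.+1)%N.
Proof.
move=> fullL p_pr Gg og.
have [sp [usp esp] szp] := torus_torsion R fullL (prime_gt0 p_pr).
(* Fixed points are p-torsion, so sifting the finite list of torsion points finds them all. *)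
pose s := [seq x <- sp | act g x == x].
have es : enumerates s (fun x => act g x = x).
  split=> [|x]; first exact: filter_uniq.
  rewrite mem_filter; split=> [/andP[/eqP]|gx] //.
  by apply/andP; split; [apply/eqP | apply/esp/(fix_prime_power_torsion p_pr Gg og)].
exists s => //.
have LA := lattice_endo_repr Gg.
pose f : T -> T := torus_horner (rC g) ('X - 1).
have fE x : f x = act g x - x.
  by rewrite /f torus_hornerD // torus_hornerN torus_hornerX torus_horner1.
have fB : zmod_morphism f.
  move=> x y; rewrite !fE [act g (x - y)](torus_mulB x y LA).
  by rewrite [- (act g y - y)]opprD addrACA -opprD.
pose fA : {additive T -> T} := HB.pack f (GRing.isZmodMorphism.Build T T f fB).
have g1 : g != 1%g.
  by rewrite -order_eq1 og -(expn0 p) eqn_exp2l ?prime_gt1.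
pose f' x : T := torus_mul (invmx (rC g - 1%:M)) x.
have f'K : cancel f' fA.
  move=> x; rewrite /= /f /torus_horner int_hornerX_sub1.
  rewrite -torus_mulM ?mulmxV ?torus_mul1 ?fpf_sub1_unit //.
  by apply: lattice_endoD => //; apply/lattice_endoN/lattice_endo1.
have es' : enumerates s (fun x => fA x = 0).
  split=> [|x]; first exact: es.1.
  rewrite /= fE; apply: (iff_trans (es.2 x)).
  by split=> [->|/eqP]; rewrite ?subrr // subr_eq0 => /eqP.
have [s' [us' es''] <-] := enumerates_ker_iter (totient (p ^ k.+1)) f'K es'.
rewrite -szp; apply: (@enumerates_size _ _ _ (fun x => x *+ p = 0)) => //.
split=> // x; apply: (iff_trans (es'' x)).
exact: (ker_sub1_totient LA p_pr (int_horner_cyclotomic p_pr Gg og)).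
Qed.

Lemma fix_prime_torsion g p x : prime p -> g \in G -> (p %| #[g]%g)%N ->
  act g x = x -> x *+ p = 0.
Proof.
move=> p_pr Gg pg gx.
apply: (@fix_prime_power_torsion (g ^+ (#[g] %/ p))%g p 0) => //.
- exact: groupX.
- by rewrite expn1 orderXdiv ?dvdn_div // divnA // mulKn // order_gt0.
- exact: torus_act_fixX.
Qed.

Lemma fix_not_prime_power g p q x : prime p -> prime q -> p != q -> g \in G ->
    (p %| #[g]%g)%N -> (q %| #[g]%g)%N ->
  act g x = x -> x = 0.
Proof.
move=> p_pr q_pr pq Gg pg qg gx.
apply: (@mulrn_coprime_eq0 _ _ p q); rewrite ?prime_gt0 //.
- by rewrite prime_coprime // dvdn_prime2.
- exact: (fix_prime_torsion p_pr Gg pg gx).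
- exact: (fix_prime_torsion q_pr Gg qg gx).
Qed.

End FixedPoints.

(** * Counting singular points *)

(** The sets are glued at [x0] only, so each one adds its points other than [x0] to the count. *)
Lemma enumerates_bouquet (I T : eqType) (x0 : T) (r : seq I) (t : I -> seq T)
    (P : I -> T -> Prop) :
    uniq r -> {in r, forall i, enumerates (t i) (P i) /\ P i x0} ->
    {in r &, forall i j x, i != j -> P i x -> P j x -> x = x0} ->
  exists2 s, enumerates s (fun x => x = x0 \/ exists2 i, i \in r & P i x)
    & size s = (1 + \sum_(i <- r) (size (t i)).-1)%N.
Proof.
elim: r => [|i r IHr] /=; first move=> _ _ _.
  exists [:: x0]; last by rewrite big_nil.
  split=> // x; rewrite inE; split=> [/eqP|[->|[]] //]; by left.
case/andP=> ir ur Pt Pdisj.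
have [||s [us es] sz] := IHr ur.
- by move=> j jr; apply: Pt; rewrite inE jr orbT.
- by move=> j k jr kr; apply: Pdisj; rewrite inE ?jr ?kr orbT.
have [[ut et] Pi0] := Pt i (mem_head _ _).
exists (s ++ rem x0 (t i)); last first.
  have x0t : x0 \in t i by apply/et.
  by rewrite size_cat sz big_cons size_rem // -addnA; congr (_ + _)%N; rewrite addnC.
split=> [|x].
  rewrite cat_uniq us rem_uniq // andbT /=; apply/hasPn => x.
  rewrite mem_rem_uniq // inE => /andP[/eqP xx0 /et Pix]; apply/negP => /es[//|[j jr Pjx]].
  apply/xx0/(Pdisj i j) => //; rewrite ?mem_head // ?inE ?jr ?orbT //.
  by apply: contraNneq ir => ->.
rewrite mem_cat mem_rem_uniq // inE; split.
  case/orP => [/es[->|[j jr Pjx]]|/andP[_ /et Pix]]; first by left.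
    by right; exists j; rewrite // inE jr orbT.
  by right; exists i; rewrite ?mem_head.
have [-> _|xx0 [//|[j]]] := eqVneq x x0.
  by apply/orP; left; apply/es; left.
  by move=> x_eq; rewrite x_eq eqxx in xx0.
rewrite inE => /orP[/eqP ->|jr] Pjx; apply/orP.
  by right; apply/et.
by left; apply/es; right; exists j.
Qed.

(** For the least prime divisor p of [d], the part of [d] prime to p is either 1 or supplies a
    second prime. *)
Lemma prime_powerP d : (1 < d)%N ->
  (exists p k, prime p /\ d = (p ^ k.+1)%N) \/
  (exists p q, [/\ prime p, prime q, p != q, (p %| d)%N & (q %| d)%N]).
Proof.
move=> d_gt1; pose p := pdiv d; have p_pr : prime p by apply: pdiv_prime.
have d_gt0 := ltnW d_gt1.
have pd : (p %| d)%N by apply: pdiv_dvd.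
have lp : (0 < logn p d)%N by rewrite logn_gt0 mem_primes p_pr d_gt0.
pose c := (d`_(negn p))%N; have dE : (d`_p * c = d)%N := partnC p d_gt0.
have [le1|gt1] := leqP c 1.
  left; exists p, (logn p d).-1; split=> //; rewrite prednK // -p_part -[LHS]dE.
  have : (0 < c)%N := part_gt0 (negn p) d.
  by case: c le1 {dE} => [|[|]] // _ _; rewrite muln1.
right; exists p, (pdiv c); have q_pr := pdiv_prime gt1; split=> //.
  have := pnatPpi (part_pnat (negn p) d) (_ : pdiv c \in \pi(c)).
  by rewrite pi_pdiv gt1 inE /= eq_sym; apply.
by apply: dvdn_trans (pdiv_dvd _) (dvdn_part (negn p) d).
Qed.

(** A cyclic group has one subgroup of order [d], and the elements of order [d] are its
    generators. *)
Lemma card_order_cycle (gT : finGroupType) (a : gT) d : (d %| #[a]%g)%N ->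
  #|[set g in <[a]>%g | #[g]%g == d]%SET| = totient d.
Proof.
move=> da; have d_gt0 := dvdn_gt0 (order_gt0 a) da.
pose h := (a ^+ (#[a] %/ d))%g.
have oh : #[h]%g = d by rewrite orderXdiv ?dvdn_div // divnA // mulKn // order_gt0.
have ha : (<[h]> \subset <[a]>)%g by rewrite cycle_subG mem_cycle.
rewrite -oh totient_gen; apply: eq_card => g; rewrite !inE /generator oh.
apply/andP/idP => [[ga /eqP og]|/eqP hg].
  have gs : (<[g]> \subset <[a]>)%g by rewrite cycle_subG.
  rewrite (eq_subG_cyclic (cycle_cyclic a) ha gs); apply/eqP.
  by rewrite -[LHS]/#[h]%g -[RHS]/#[g]%g oh og.
by split; [rewrite -cycle_subG -hg | rewrite -oh /order hg].
Qed.

Lemma natr_root_powR (R : realType) (c p n e : nat) : (0 < e)%N ->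
  (c ^ e = p ^ n)%N -> c%:R = p%:R `^ (n%:R / e%:R) :> R.
Proof.
move=> e_gt0 ce; rewrite powRrM powR_mulrn ?ler0n // -natrX -ce natrX.
rewrite -powR_mulrn ?ler0n // -powRrM mulfV ?powRr1 ?ler0n //.
by rewrite pnatr_eq0 -lt0n.
Qed.

Section PrimePowerSums.
Variables (R : realType) (N : nat) (F : nat -> nat -> R).

Lemma sum_prime_powers_eq p k : (0 < N)%N -> prime p -> (p ^ k.+1 %| N)%N ->
  \sum_(q <- primes N) \sum_(1 <= j < (logn q N).+1)
    (if (p ^ k.+1 == q ^ j)%N then F q j else 0) = F p k.+1.
Proof.
move=> N_gt0 p_pr pN.
have kN : (k < logn p N)%N by rewrite -pfactor_dvdn.
have pN1 : p \in primes N by rewrite -logn_gt0 (leq_ltn_trans _ kN).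
rewrite (bigD1_seq p) ?primes_uniq //= [X in _ + X]big1_seq ?addr0; last first.
  move=> q /andP[qp]; rewrite mem_primes => /andP[q_pr _]; rewrite big1 // => j _.
  case: eqP => // e; have : (p %| q ^ j)%N by rewrite -e dvdn_exp.
  by rewrite Euclid_dvdX // dvdn_prime2 // eq_sym (negPf qp).
rewrite (bigD1_seq k.+1) ?iota_uniq ?mem_index_iota //= eqxx big1_seq ?addr0 //.
move=> j /andP[jk _]; rewrite eqn_exp2l ?prime_gt1 //.
by rewrite eq_sym (negPf jk).
Qed.

Lemma sum_prime_powers_neq d p q : prime p -> prime q -> p != q ->
    (p %| d)%N -> (q %| d)%N ->
  \sum_(r <- primes N) \sum_(1 <= j < (logn r N).+1)
    (if (d == r ^ j)%N then F r j else 0) = 0.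
Proof.
move=> p_pr q_pr pq pd qd; rewrite big1_seq // => r.
rewrite mem_primes => /andP[_ /andP[r_pr _]]; rewrite big1 // => j _.
case: eqP => // e; move: pd qd; rewrite e !Euclid_dvdX // !dvdn_prime2 //.
by move=> /andP[/eqP pr _] /andP[/eqP qr _]; rewrite pr qr eqxx in pq.
Qed.

End PrimePowerSums.

Section Counting.
Variables (R : realType) (gT : finGroupType) (G : {group gT}) (n : nat).
Variables (rG : mx_representation rat G n.+1) (L : zmodClosed 'cV[rat]_n.+1).
Hypothesis fpfG : fpf_repr rG.
Hypothesis stabL : stable_lattice rG L.
Hypothesis fullL : full_rank_lattice L.
Local Notation T := (torus R L).
Local Notation act := (@torus_act R gT G n.+1 rG L).
Local Notation c p k := ((p : nat)%:R `^ (n.+1%:R / (totient (p ^ k)%N)%:R) : R).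

(** At most one term of the double sum is nonzero. This form covers all orders at once and lets the
    sum over [g] be exchanged with the sum over prime powers. *)
Lemma card_fix g N : (0 < N)%N -> g \in G -> g != 1%g -> (#[g]%g %| N)%N ->
  exists2 s, enumerates s (fun x => act g x = x) &
    (size s)%:R = 1 + \sum_(p <- primes N) \sum_(1 <= k < (logn p N).+1)
      (if (#[g]%g == p ^ k)%N then c p k - 1 else 0).
Proof.
move=> N_gt0 Gg g1 gN.
have [|[p [k [p_pr og]]]|[p [q [p_pr q_pr pq pg qg]]]] := @prime_powerP #[g]%g.
- by rewrite order_gt1.
- have [s es sz] := card_fix_prime_power R fpfG stabL fullL p_pr Gg og.
  exists s => //; rewrite og (@sum_prime_powers_eq _ _ (fun p k => c p k - 1)) -?og //.
  rewrite og in sz *; rewrite addrC subrK; apply: natr_root_powR sz.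
  by rewrite totient_gt0 expn_gt0 prime_gt0.
exists [:: 0].
  split=> // x; rewrite inE; split=> [/eqP ->|gx]; first exact: torus_act0.
  exact/eqP/(fix_not_prime_power fpfG stabL p_pr q_pr pq Gg pg qg).
by rewrite (@sum_prime_powers_neq _ _ (fun p k => c p k - 1) _ p q) ?addr0.
Qed.

Variables (m : nat) (a : gT).
Hypothesis m_gt0 : (0 < m)%N.
Hypothesis Ga : a \in G.
Hypothesis oa : #[a]%g = (2 * m)%N.
Hypothesis oG : #|G| = (4 * m)%N.
Hypothesis sqG : forall g, g \in G -> g \notin <[a]>%g -> (g ^+ 2 = a ^+ m)%g.

Let N_gt0 : (0 < 2 * m)%N. Proof. by rewrite muln_gt0. Qed.

Let a_m : (a ^+ m)%g != 1%g.
Proof. by rewrite -order_dvdn oa gtnNdvd // mul2n -addnn -{1}(add0n m) ltn_add2r. Qed.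

(** Outside <a> the order of [g] divides 4, so a prime order would be 2, against g^2 = a^m. *)
Lemma prime_order_cycle g : g \in G -> prime #[g]%g -> g \in <[a]>%g.
Proof.
move=> Gg pg; apply: contraT => ga.
have g4 : (g ^+ (2 * 2) = 1)%g.
  by rewrite (expgM g) (sqG Gg ga) -(expgM a) mulnC -oa expg_order.
have : (#[g]%g %| 2 ^ 2)%N by rewrite order_dvdn [(2 ^ 2)%N]/(2 * 2)%N g4.
rewrite Euclid_dvdX // andbT dvdn_prime2 // => /eqP g2.
by move: a_m; rewrite -(sqG Gg ga) -g2 expg_order eqxx.
Qed.

(** A power of [g] has prime order p and still fixes [x]. It generates the subgroup of order p of
    <a>, so a^(2m/p) is one of its powers. *)
Lemma nontrivial_stabilizerP (x : T) :
  (exists g, [/\ g \in G, g != 1%g & act g x = x]) <->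
  exists2 p, p \in primes (2 * m) & act (a ^+ (2 * m %/ p))%g x = x.
Proof.
split=> [[g [Gg g1 gx]]|[p]]; last first.
  rewrite mem_primes => /and3P[p_pr _ pN] px; exists (a ^+ (2 * m %/ p))%g.
  split=> //; first exact: groupX.
  rewrite -order_eq1 orderXdiv oa ?dvdn_div // divnA // mulKn //.
  by rewrite neq_ltn prime_gt1 // orbT.
have g_gt1 : (1 < #[g]%g)%N by rewrite order_gt1.
pose p := pdiv #[g]%g; have p_pr : prime p by apply: pdiv_prime.
have pg : (p %| #[g]%g)%N by apply: pdiv_dvd.
pose h := (g ^+ (#[g] %/ p))%g.
have Gh : h \in G by apply: groupX.
have oh : #[h]%g = p by rewrite orderXdiv ?dvdn_div // divnA // mulKn.
have hx : act h x = x by apply: torus_act_fixX.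
have ha : h \in <[a]>%g by apply: prime_order_cycle; rewrite ?oh.
have pN : (p %| 2 * m)%N by rewrite -oa -oh order_dvdG.
exists p; first by rewrite mem_primes p_pr N_gt0.
have ok : #[(a ^+ (2 * m %/ p))%g]%g = p.
  by rewrite orderXdiv oa ?dvdn_div // divnA // mulKn.
have /cycleP[i ->] : (a ^+ (2 * m %/ p))%g \in <[h]>%g.
  rewrite -cycle_subG.
  have hsub : (<[h]> \subset <[a]>)%g by rewrite cycle_subG.
  have ksub : (<[a ^+ (2 * m %/ p)]> \subset <[a]>)%g by rewrite cycle_subG mem_cycle.
  suff /eqP -> : (<[a ^+ (2 * m %/ p)]> == <[h]>)%g by [].
  rewrite (eq_subG_cyclic (cycle_cyclic a) ksub hsub); apply/eqP.
  by rewrite -[LHS]/#[_]%g -[RHS]/#[h]%g oh ok.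
exact: torus_act_fixX.
Qed.

(** The first two summands are |F|. The parenthesis is the sum of |Fix g| over g different from 1:
    first over <a>, where phi(p^k) elements have order p^k, then over the 2m elements of order 4
    outside <a>. *)
Lemma card_singular_points :
  finite_set (singular_points R rG L) /\
  #|` fset_set (singular_points R rG L)|%:R * (4 * m)%N%:R =
    1 + \sum_(p <- primes (2 * m)) (c p 1 - 1)
    + ((2 * m)%N%:R - 1 + \sum_(p <- primes (2 * m))
         \sum_(1 <= k < (logn p (2 * m)).+1)
           (totient (p ^ k)%N)%:R * (c p k - 1)
       + (2 * m)%N%:R * c 2 2) :> R.
Proof.
have fixP g : exists s, g \in G -> g != 1%g -> enumerates s (fun x => act g x = x).
  have [Gg|] := boolP (g \in G); last by exists [::].
  have [|g1] := eqVneq g 1%g; first by exists [::].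
  by have [s es _] := card_fix (order_gt0 g) Gg g1 (dvdnn _); exists s.
have [t tP] := choice fixP.
have t_card g : g \in G -> g != 1%g -> (#[g]%g %| 2 * m)%N ->
    (size (t g))%:R = 1 + \sum_(p <- primes (2 * m))
      \sum_(1 <= k < (logn p (2 * m)).+1)
      (if (#[g]%g == p ^ k)%N then c p k - 1 else 0).
  move=> Gg g1 gN; have [s es <-] := card_fix N_gt0 Gg g1 gN.
  by rewrite (enumerates_size (tP g Gg g1) es).
pose b p := (a ^+ (2 * m %/ p))%g.
have ob p : p \in primes (2 * m) -> #[b p]%g = p.
  rewrite mem_primes => /and3P[p_pr _ pN].
  by rewrite orderXdiv oa ?dvdn_div // divnA // mulKn.
have ob1 p : p \in primes (2 * m) -> #[b p]%g = (p ^ 1)%N.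
  by rewrite expn1; apply: ob.
have Gb p : b p \in G by apply: groupX.
have b1 p : p \in primes (2 * m) -> b p != 1%g.
  move=> pN; rewrite -order_eq1 ob //.
  by move: pN; rewrite mem_primes => /andP[p_pr _]; rewrite neq_ltn prime_gt1 // orbT.
have [||sF [usF esF] szF] := @enumerates_bouquet nat T 0 (primes (2 * m))
    (fun p => t (b p)) (fun p x => act (b p) x = x) (primes_uniq _).
- by move=> p pN; split; [apply: tP => //; apply: b1 | apply: torus_act0].
- move=> p q pN qN x pq px qx.
  move: (pN) (qN); rewrite !mem_primes => /andP[p_pr _] /andP[q_pr _].
  apply: (@mulrn_coprime_eq0 _ _ p q); rewrite ?prime_gt0 //.
  + by rewrite prime_coprime // dvdn_prime2.
  + by apply: (fix_prime_torsion fpfG stabL p_pr (Gb p) _ px); rewrite ob.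
  + by apply: (fix_prime_torsion fpfG stabL q_pr (Gb q) _ qx); rewrite ob.
have esF' : enumerates sF (fun x => exists g, [/\ g \in G, g != 1%g & act g x = x]).
  split=> // x; apply: (iff_trans (esF x)).
  apply: (iff_trans _ (iff_sym (nontrivial_stabilizerP x))).
  split=> [[->|//]|]; last by right.
  (* The point 0 lies in F because 2m has a prime divisor, for instance 2. *)
  exists 2%N; first by rewrite mem_primes N_gt0 dvdn_mulr.
  by apply: torus_act0 => //; apply: groupX.
have actM : {in G &, forall g h x, act (g * h)%g x = act g (act h x)}.
  by move=> g h Gg Gh x; apply: torus_actM.
have [orbs eo szo] :=
  card_orbits_nontrivial_stabilizer (@torus_act1 R _ _ _ rG L) actM esF' tP.
have [fin cardo] := enumerates_card eo.
split=> //; rewrite [#|` _|]cardo -oG -natrM szo natrD szF; congr (_ + _).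
  rewrite natrD natr_sum; congr (_ + _); apply: eq_big_seq => p pN.
  (* The point 0 is fixed, so the predecessor of the size is a true subtraction. *)
  have sz1 : (0 < size (t (b p)))%N.
    have := (tP (b p) (Gb p) (b1 p pN)).2 0.
    by rewrite torus_act0 // => -[_ /(_ erefl)]; case: (t _).
  move: (pN); rewrite mem_primes => /andP[p_pr _].
  have [s es sz] := card_fix_prime_power R fpfG stabL fullL p_pr (Gb p) (ob1 p pN).
  have := enumerates_size es (tP (b p) (Gb p) (b1 p pN)) => sz'.
  rewrite -subn1 natrB // -sz' (natr_root_powR _ _ sz) //.
  by rewrite totient_gt0 expn_gt0 prime_gt0.
rewrite natr_sum (bigID [in <[a]>%g]) /=; congr (_ + _).
  have sub g : g \in <[a]>%g -> g \in G.
    by apply/fintype.subsetP; rewrite cycle_subG.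
  have gN g : g \in <[a]>%g -> (#[g]%g %| 2 * m)%N.
    by move=> ga; rewrite -oa order_dvdG.
  rewrite (eq_bigl (fun g => (g \in <[a]>%g) && (g != 1%g))); last first.
    by move=> g /=; case: (boolP (g \in <[a]>%g)) => [/sub->|]; rewrite ?andbT ?andbF.
  pose S (g : gT) : R := \sum_(p <- primes (2 * m)) \sum_(1 <= k < (logn p (2 * m)).+1)
      (if (#[g]%g == p ^ k)%N then c p k - 1 else 0).
  rewrite (eq_bigr (fun g : gT => 1 + S g)); last first.
    by move=> g /andP[ga g1]; rewrite t_card ?sub ?gN.
  rewrite big_split /=; congr (_ + _).
    have := cardsD1 1%g <[a]>%g; rewrite group1 -orderE oa => ->.
    rewrite natrD addrC addKr sumr_const; congr (_ %:R); apply: eq_card => g.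
    by rewrite !inE andbC.
  (* The exponent k starts at 1, so the order of the identity is never counted as a prime power, and
     the identity may be put back into the sum over <a>. *)
  have S1 : S 1%g = 0.
    rewrite /S big1_seq // => p; rewrite mem_primes => /andP[_ /andP[p_pr _]].
    rewrite big1_seq // => k; rewrite mem_index_iota order1 => /andP[_ /andP[k0 _]].
    case: eqP => // /esym/eqP; rewrite -[X in _ == X](expn0 p).
    by rewrite eqn_exp2l ?prime_gt1 //; case: k k0.
  transitivity (\sum_(g in <[a]>%g) S g).
    rewrite [RHS](bigD1 1%g) ?group1 //= S1 add0r; apply: eq_bigl => g.
    by [].
  rewrite exchange_big /=; apply: eq_big_seq => p.
  rewrite mem_primes => /andP[p_pr _].
  rewrite exchange_big /=; apply: eq_big_seq => k.
  rewrite mem_index_iota => /andP[_ kN].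
  rewrite -big_mkcondr /= sumr_const -[LHS]mulr_natl; congr (_%:R * _).
  rewrite -(@card_order_cycle _ a) ?oa ?pfactor_dvdn //.
  by apply: eq_card => g; rewrite !inE.
transitivity (\sum_(g in G :\: <[a]>%g) c 2 2).
  apply: eq_big => g.
    by rewrite !inE; case: eqP => [->|]; rewrite ?group1 // andbT andbC.
  move=> /andP[/andP[Gg g1] ga].
  (* The square of [g] is a^m, which has order 2. *)
  have og : #[g]%g = (2 ^ 1.+1)%N.
    rewrite -[RHS]/(2 * 2)%N; apply: orderXprime => //.
    rewrite sqG // orderXdiv oa; last exact: dvdn_mull.
    by rewrite mulnK.
  have [s es sz] := card_fix_prime_power R fpfG stabL fullL (isT : prime 2) Gg og.
  by rewrite (enumerates_size (tP g Gg g1) es) (natr_root_powR _ _ sz).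
rewrite sumr_const -[LHS]mulr_natl; congr (_%:R * _).
rewrite cardsD (finset.setIidPr _) ?cycle_subG // oG [X in (_ - X)%N]oa.
by rewrite -mulnBl.
Qed.

End Counting.

Theorem theorem4p7 (R : realType) (m : nat) (gT : finGroupType)
    (G : {group gT}) (n : nat) (rG : mx_representation rat G n)
    (L : zmodClosed 'cV[rat]_n) :
  (2 <= m)%N ->
  generalized_quaternion m G ->
  fpf_repr rG ->
  full_rank_lattice L ->
  stable_lattice rG L ->
  finite_set (singular_points R rG L) /\
  (#|` fset_set (singular_points R rG L)|%:R : R) =
    2 `^ (n%:R / 2 - 1) + 1 / 2
    - (size (primes (2 * m)%N))%:R / (4 * m)%N%:R
    + 1 / (4 * m)%N%:R * \sum_(p <- primes (2 * m)%N) p%:R `^ (n%:R / (p%:R - 1))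
    + 1 / (4 * m)%N%:R *
      \sum_(p <- primes (2 * m)%N) \sum_(1 <= k < (logn p (2 * m)).+1)
        (totient (p ^ k)%N)%:R *
        (p%:R `^ (n%:R / (totient (p ^ k)%N)%:R) - 1).

Proof.
move=> m_ge2 quatG; case: n rG L => [|n'] rG' L' fpfG fullL stabL.
  by case: fpfG.
have m_gt0 : (0 < m)%N := ltnW m_ge2.
have [a [Ga oa oG sqG]] := generalized_quaternionP m_gt0 quatG.
have [fin card] :=
  card_singular_points R fpfG stabL fullL m_gt0 Ga oa oG sqG.
split=> //; set c := (#|` _|%:R) in card *.
have nz4m : (4 * m)%N%:R != 0 :> R by rewrite pnatr_eq0 -lt0n muln_gt0 m_gt0.
apply: (mulIf nz4m); rewrite {}card.
have -> : 2 `^ (n'.+1%:R / 2 - 1) = 2 `^ (n'.+1%:R / 2) / 2 :> R.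
  by rewrite powRB ?powRr1 //; apply/implyP => _; rewrite pnatr_eq0.
have -> : totient (2 ^ 2) = 2%N by [].
have -> : \sum_(p <- primes (2 * m))
      ((p%:R : R) `^ (n'.+1%:R / (totient (p ^ 1))%:R) - 1) =
    \sum_(p <- primes (2 * m)) p%:R `^ (n'.+1%:R / (p%:R - 1)) -
    (size (primes (2 * m)))%:R.
  rewrite sumrB; congr (_ - _); last by rewrite big_const_seq count_predT iter_addr_0.
  apply: eq_big_seq => p; rewrite mem_primes => /andP[p_pr _].
  by rewrite totient_pfactor // muln1 -subn1 natrB ?prime_gt0.
move: (\sum_(p <- _) \sum_(_ <= _ < _) _) (\sum_(p <- _) _) => S2 S1.
rewrite !natrM.
have nzm : m%:R != 0 :> R by rewrite pnatr_eq0 -lt0n.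
by field.
Qed.
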